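(* Let $\mathbb{K}$ be a field, let $(\Omega,\leftarrow,\rightarrow,\triangleleft,\triangleright)$ be an extended diassociative semigroup (EDS) and let $A$ be a $\mathbb{K}$-vector space equipped with bilinear products $\prec_\alpha$ and $\succ_\alpha$ for $\alpha\in\Omega$. Equip $\mathbb{K}\Omega\otimes A$ with the two bilinear products $\prec,\succ$ defined, for all $\alpha,\beta\in\Omega$ and $x,y\in A$, by $$(\alpha\otimes x)\prec(\beta\otimes y)=(\alpha\leftarrow\beta)\otimes(x\prec_{\alpha\triangleleft\beta}y),\qquad(\alpha\otimes x)\succ(\beta\otimes y)=(\alpha\rightarrow\beta)\otimes(x\succ_{\alpha\triangleright\beta}y).$$ 1. If $(A,(\prec_\alpha)_{\alpha\in\Omega},(\succ_\alpha)_{\alpha\in\Omega})$ is an $\Omega$-dendriform algebra, then $(\mathbb{K}\Omega\otimes A,\prec,\succ)$ is a dendriform algebra. 2. If the maps $\varphi_\leftarrow:(\alpha,\beta)\mapsto(\alpha\leftarrow\beta,\alpha\triangleleft\beta)$ and $\varphi_\rightarrow:(\alpha,\beta)\mapsto(\alpha\rightarrow\beta,\alpha\triangleright\beta)$ from $\Omega^2$ to $\Omega^2$ are surjective, then the converse implication is true.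
   Context: Extended diassociative semigroups. A diassociative semigroup is a set $\Omega$ with maps $\leftarrow,\rightarrow:\Omega\times\Omega\to\Omega$ such that for all $\alpha,\beta,\gamma\in\Omega$: $(\alpha\leftarrow\beta)\leftarrow\gamma=\alpha\leftarrow(\beta\leftarrow\gamma)=\alpha\leftarrow(\beta\rightarrow\gamma)$; $(\alpha\rightarrow\beta)\leftarrow\gamma=\alpha\rightarrow(\beta\leftarrow\gamma)$; $(\alpha\rightarrow\beta)\rightarrow\gamma=(\alpha\leftarrow\beta)\rightarrow\gamma=\alpha\rightarrow(\beta\rightarrow\gamma)$. An extended diassociative semigroup (EDS) is $(\Omega,\leftarrow,\rightarrow,\triangleleft,\triangleright)$ such that $(\Omega,\leftarrow,\rightarrow)$ is a diassociative semigroup and for all $\alpha,\beta,\gamma\in\Omega$: $\alpha\triangleright(\beta\leftarrow\gamma)=\alpha\triangleright\beta$; $(\alpha\rightarrow\beta)\triangleleft\gamma=\beta\triangleleft\gamma$; $(\alpha\triangleleft\beta)\leftarrow((\alpha\leftarrow\beta)\triangleleft\gamma)=\alpha\triangleleft(\beta\leftarrow\gamma)$; $(\alpha\triangleleft\beta)\triangleleft((\alpha\leftarrow\beta)\triangleleft\gamma)=\beta\triangleleft\gamma$; $(\alpha\triangleleft\beta)\rightarrow((\alpha\leftarrow\beta)\triangleleft\gamma)=\alpha\triangleleft(\beta\rightarrow\gamma)$; $(\alpha\triangleleft\beta)\triangleright((\alpha\leftarrow\beta)\triangleleft\gamma)=\beta\triangleright\gamma$; $(\alpha\triangleright(\beta\rightarrow\gamma))\leftarrow(\beta\triangleright\gamma)=(\alpha\leftarrow\beta)\triangleright\gamma$;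 $(\alpha\triangleright(\beta\rightarrow\gamma))\triangleleft(\beta\triangleright\gamma)=\alpha\triangleleft\beta$; $(\alpha\triangleright(\beta\rightarrow\gamma))\rightarrow(\beta\triangleright\gamma)=(\alpha\rightarrow\beta)\triangleright\gamma$; $(\alpha\triangleright(\beta\rightarrow\gamma))\triangleright(\beta\triangleright\gamma)=\alpha\triangleright\beta$. $\Omega$-dendriform algebra: a $\mathbb{K}$-vector space $A$ with bilinear products $\prec_\alpha,\succ_\alpha$ ($\alpha\in\Omega$) such that for all $x,y,z\in A$, $\alpha,\beta\in\Omega$: $(x\prec_\alpha y)\prec_\beta z=x\prec_{\alpha\leftarrow\beta}(y\prec_{\alpha\triangleleft\beta}z)+x\prec_{\alpha\rightarrow\beta}(y\succ_{\alpha\triangleright\beta}z)$; $x\succ_\alpha(y\prec_\beta z)=(x\succ_\alpha y)\prec_\beta z$; $x\succ_\alpha(y\succ_\beta z)=(x\succ_{\alpha\triangleright\beta}y)\succ_{\alpha\rightarrow\beta}z+(x\prec_{\alpha\triangleleft\beta}y)\succ_{\alpha\leftarrow\beta}z$. Dendriform algebra: a vector space with bilinear products $\prec,\succ$ such that $(x\prec y)\prec z=x\prec(y\prec z+y\succ z)$, $(x\succ y)\prec z=x\succ(y\prec z)$, $(x\prec y+x\succ y)\succ z=x\succ(y\succ z)$. $\mathbb{K}\Omega$ is the vector space with basis $\Omega$. *)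

(* Defs.v *)
From HB Require Import structures.
From mathcomp Require Import all_boot all_algebra.
From mathcomp Require Import boolp.
From mathcomp Require Import finmap monalg.

Set Implicit Arguments.
Unset Strict Implicit.
Unset Printing Implicit Defensive.

Import GRing.Theory.
Local Open Scope ring_scope.
Local Open Scope quotient_scope.

Section ExtendedDiassociativeSemigroup.

Variables (Omega : Type) (la ra lt rt : Omega -> Omega -> Omega).

Local Notation "a ← b" := (la a b) (at level 40, left associativity).
Local Notation "a → b" := (ra a b) (at level 40, left associativity).
Local Notation "a ◁ b" := (lt a b) (at level 40, left associativity).
Local Notation "a ▷ b" := (rt a b) (at level 40, left associativity).

Record diassociative_semigroup : Prop := {
  dias_ll : forall a b c, (a ← b) ← c = a ← (b ← c);
  dias_lr : forall a b c, a ← (b ← c) = a ← (b → c);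
  dias_rl : forall a b c, (a → b) ← c = a → (b ← c);
  dias_rr : forall a b c, (a → b) → c = (a ← b) → c;
  dias_rA : forall a b c, (a ← b) → c = a → (b → c)
}.

Record extended_diassociative_semigroup : Prop := {
  eds_dias : diassociative_semigroup;
  eds_rt_l : forall a b c, a ▷ (b ← c) = a ▷ b;
  eds_r_lt : forall a b c, (a → b) ◁ c = b ◁ c;
  eds_lt_l : forall a b c, (a ◁ b) ← ((a ← b) ◁ c) = a ◁ (b ← c);
  eds_lt_lt : forall a b c, (a ◁ b) ◁ ((a ← b) ◁ c) = b ◁ c;
  eds_lt_r : forall a b c, (a ◁ b) → ((a ← b) ◁ c) = a ◁ (b → c);
  eds_lt_rt : forall a b c, (a ◁ b) ▷ ((a ← b) ◁ c) = b ▷ c;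
  eds_rt_lA : forall a b c, (a ▷ (b → c)) ← (b ▷ c) = (a ← b) ▷ c;
  eds_rt_lt : forall a b c, (a ▷ (b → c)) ◁ (b ▷ c) = a ◁ b;
  eds_rt_r : forall a b c, (a ▷ (b → c)) → (b ▷ c) = (a → b) ▷ c;
  eds_rt_rt : forall a b c, (a ▷ (b → c)) ▷ (b ▷ c) = a ▷ b
}.

Record Omega_dendriform (K : fieldType) (A : lmodType K)
    (prec succ : Omega -> {bilinear A -> A -> A}) : Prop := {
  Odend_prec_prec : forall a b x y z,
    prec b (prec a x y) z
    = prec (a ← b) x (prec (a ◁ b) y z) + prec (a → b) x (succ (a ▷ b) y z);
  Odend_succ_prec : forall a b x y z,
    succ a x (prec b y z) = prec b (succ a x y) z;
  Odend_succ_succ : forall a b x y z,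
    succ a x (succ b y z)
    = succ (a → b) (succ (a ▷ b) x y) z + succ (a ← b) (prec (a ◁ b) x y) z
}.

End ExtendedDiassociativeSemigroup.

Record dendriform (K : fieldType) (V : lmodType K)
    (prec succ : {bilinear V -> V -> V}) : Prop := {
  dend_prec_prec : forall x y z,
    prec (prec x y) z = prec x (prec y z + succ y z);
  dend_succ_prec : forall x y z, prec (succ x y) z = succ x (prec y z);
  dend_succ_succ : forall x y z,
    succ (prec x y + succ x y) z = succ x (succ y z)
}.

(* The vector space with basis [X]. *)
Definition free_vect (K : fieldType) (X : choiceType) : lmodType K :=
  {malg K[X]}.

(* Locked: unifying the underlying finite maps by computation is intractable. *)
Definition basis_vect (K : fieldType) (X : choiceType) : X -> free_vect K X :=
  locked (fun x => << x >>).

Arguments basis_vect {K X} x.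

Lemma basis_vectE (K : fieldType) (X : choiceType) (x : X) :
  basis_vect x = << x >> :> free_vect K X.
Proof. by rewrite /basis_vect -lock. Qed.

Definition prod_choice (X Y : choiceType) : choiceType := (X * Y)%type.

Section FreeLift.

Variables (K : fieldType) (X : choiceType) (Z : lmodType K).
Implicit Types (f g : X -> Z) (u v : free_vect K X).

(* The linear extension of [f]. *)
Definition free_lift f u : Z := \sum_(x <- msupp u) u@_x *: f x.

Lemma free_liftEw f u (d : {fset X}) :
  (msupp u `<=` d)%fset -> free_lift f u = \sum_(x <- d) u@_x *: f x.
Proof.
move=> sud; apply: (big_fset_incl _ sud) => x _ xu.
by rewrite mcoeff_outdom // scale0r.
Qed.

Lemma free_lift_linear f : linear (free_lift f).
Proof.
move=> a u v; pose d := (msupp u `|` msupp v `|` msupp (a *: u + v))%fset.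
have sd : (msupp (a *: u + v) `<=` d)%fset by apply: fsubsetUr.
have su : (msupp u `<=` d)%fset by rewrite /d -fsetUA fsubsetUl.
have sv : (msupp v `<=` d)%fset.
  by rewrite /d fsetUAC; apply: fsubsetUr.
rewrite (free_liftEw f sd) (free_liftEw f su) (free_liftEw f sv).
rewrite scaler_sumr -big_split /=; apply: eq_bigr => x _.
by rewrite mcoeffD mcoeffZ scalerDl scalerA.
Qed.

HB.instance Definition _ f :=
  GRing.isLinear.Build K (free_vect K X) Z *:%R (free_lift f) (free_lift_linear f).

Lemma free_liftU f x : free_lift f (basis_vect x) = f x.
Proof.
by rewrite /free_lift basis_vectE msuppU oner_eq0 big_seq_fset1 mcoeffUU scale1r.
Qed.

Lemma free_liftP a f g u :
  free_lift (fun x => a *: f x + g x) u = a *: free_lift f u + free_lift g u.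
Proof.
rewrite /free_lift scaler_sumr -big_split; apply: eq_bigr => x _ /=.
by rewrite scalerDr !scalerA mulrC.
Qed.

Lemma eq_free_lift f g u : f =1 g -> free_lift f u = free_lift g u.
Proof. by move=> fg; apply: eq_bigr => x _; rewrite fg. Qed.

Lemma free_ext (F G : free_vect K X -> Z) : linear F -> linear G ->
  (forall x, F (basis_vect x) = G (basis_vect x)) -> F =1 G.
Proof.
have lin0 (H : free_vect K X -> Z) : linear H -> H 0 = 0.
  by move=> lH; have := lH (-1) 0 0; rewrite scaler0 addr0 scaleN1r addNr.
move=> lF lG FG u; rewrite [u]monalgE.
elim: (X in \big[_/_]_(k <- X) _) => [|x s IH].
  by rewrite big_nil !lin0.
rewrite big_cons.
have -> : << u@_x *g x >> = u@_x *: basis_vect x :> free_vect K X.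
  by apply/malgP => k; rewrite basis_vectE mcoeffZ !mcoeffU mulrnAr mulr1.
by rewrite lF lG FG IH.
Qed.

End FreeLift.

Section TensorProduct.

Variables (K : fieldType) (V W : lmodType K).

Local Notation free := (free_vect K (prod_choice V W)).
Local Notation "'[' v ',' w ']'" := (basis_vect (v, w) : free).

(* The subspace spanned by the bilinearity relations. *)
Inductive tensor_rel : free -> Prop :=
| tensor_rel0 : tensor_rel 0
| tensor_relP a u u' : tensor_rel u -> tensor_rel u' -> tensor_rel (a *: u + u')
| tensor_rel_linl a v v' w :
    tensor_rel ([a *: v + v', w] - (a *: [v, w] + [v', w]))
| tensor_rel_linr a v w w' :
    tensor_rel ([v, a *: w + w'] - (a *: [v, w] + [v, w'])).

Definition tensor_relb (u : free) : bool := `[< tensor_rel u >].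

Lemma tensor_relb_zmod_closed : zmod_closed tensor_relb.
Proof.
split=> [|u v /asboolP Ru /asboolP Rv]; first exact/asboolP/tensor_rel0.
by apply/asboolP; rewrite -scaleN1r addrC; apply: tensor_relP.
Qed.

HB.instance Definition _ :=
  GRing.isZmodClosed.Build free tensor_relb tensor_relb_zmod_closed.

Definition tensor_submod := GRing.ZmodClosed.clone free tensor_relb _.

Definition tensor := Quotient.quot tensor_submod.

HB.instance Definition _ := GRing.Zmodule.on tensor.

Definition tensor_pi (u : free) : tensor := \pi_tensor u.

Lemma tensor_eqP (u v : free) :
  (tensor_pi u = tensor_pi v) <-> tensor_rel (u - v).
Proof.
split=> [/eqP|/asboolP uv]; last by apply/eqP; rewrite -Quotient.idealrBE.
by rewrite -Quotient.idealrBE => /asboolP.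
Qed.

Lemma tensor_reprK t : tensor_pi (repr t) = t.
Proof. exact: reprK. Qed.

Definition tensor_scale (a : K) (t : tensor) : tensor :=
  tensor_pi (a *: repr t).

Lemma tensor_piD (u v : free) : tensor_pi (u + v) = tensor_pi u + tensor_pi v.
Proof. by rewrite /tensor_pi piE. Qed.

Lemma tensor_scale_pi a u : tensor_scale a (tensor_pi u) = tensor_pi (a *: u).
Proof.
apply/tensor_eqP; rewrite -scalerBr -[X in tensor_rel X]addr0.
apply: tensor_relP; last exact: tensor_rel0.
by apply/tensor_eqP; rewrite tensor_reprK.
Qed.

Lemma tensor_scaleA a b t :
  tensor_scale a (tensor_scale b t) = tensor_scale (a * b) t.
Proof.
by rewrite -[t]tensor_reprK [tensor_scale b _]tensor_scale_pi !tensor_scale_pi scalerA.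
Qed.

Lemma tensor_scale1 t : tensor_scale 1 t = t.
Proof. by rewrite -[t]tensor_reprK tensor_scale_pi scale1r. Qed.

Lemma tensor_scaleDr a : {morph tensor_scale a : s t / s + t}.
Proof.
move=> s t; rewrite -[s]tensor_reprK -[t]tensor_reprK -tensor_piD !tensor_scale_pi.
by rewrite scalerDr tensor_piD.
Qed.

Lemma tensor_scaleDl t : {morph tensor_scale^~ t : a b / a + b}.
Proof.
by move=> a b; rewrite -[t]tensor_reprK !tensor_scale_pi scalerDl tensor_piD.
Qed.

HB.instance Definition _ := GRing.Zmodule_isLmodule.Build K tensor
  tensor_scaleA tensor_scale1 tensor_scaleDr tensor_scaleDl.

Definition tens (v : V) (w : W) : tensor := tensor_pi [v, w].

Lemma tensor_piP a (u v : free) :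
  tensor_pi (a *: u + v) = a *: tensor_pi u + tensor_pi v.
Proof. by rewrite tensor_piD -tensor_scale_pi. Qed.

Lemma tens_bilinear : bilinear_for *:%R *:%R tens.
Proof.
by split=> [w a v v'|v a w w'] /=; rewrite /tens -tensor_piP;
   apply/tensor_eqP; [apply: tensor_rel_linl | apply: tensor_rel_linr].
Qed.

HB.instance Definition _ :=
  bilinear_isBilinear.Build K V W tensor *:%R *:%R tens tens_bilinear.

Variable Z : lmodType K.

(* The linear map induced by [b]; it depends on the choice of [repr t] unless
   [b] is bilinear. *)
Definition tensor_lift (b : V -> W -> Z) (t : tensor) : Z :=
  free_lift (fun p => b p.1 p.2) (repr t).

Lemma tensor_lift_pi b u : bilinear_for *:%R *:%R b ->
  tensor_lift b (tensor_pi u) = free_lift (fun p => b p.1 p.2) u.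
Proof.
move=> [bl br]; apply/eqP; rewrite -subr_eq0 -raddfB /=; apply/eqP.
have : tensor_rel (repr (tensor_pi u) - u) by apply/tensor_eqP; rewrite tensor_reprK.
elim=> [|a v v' _ IH _ IH'|a v v' w|a v w w'].
- exact: raddf0.
- by rewrite linearP /= IH IH' scaler0 addr0.
- by rewrite raddfB /= linearP /= !free_liftU /= bl subrr.
- by rewrite raddfB /= linearP /= !free_liftU /= br subrr.
Qed.

Lemma tensor_liftE b v w : bilinear_for *:%R *:%R b ->
  tensor_lift b (tens v w) = b v w.
Proof. by move=> bb; rewrite tensor_lift_pi // free_liftU. Qed.

Lemma tensor_lift_linear b : bilinear_for *:%R *:%R b -> linear (tensor_lift b).
Proof.
move=> bb a s t; rewrite -[s]tensor_reprK -[t]tensor_reprK -tensor_piP !tensor_lift_pi //.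
exact: linearP.
Qed.

Lemma tensor_ext (f g : tensor -> Z) : linear f -> linear g ->
  (forall v w, f (tens v w) = g (tens v w)) -> f =1 g.
Proof.
move=> lf lg fg t; rewrite -[t]tensor_reprK.
move: (repr t); apply: free_ext => [a u v|a u v|[v w]]; last exact: fg.
  by rewrite tensor_piP lf.
by rewrite tensor_piP lg.
Qed.

End TensorProduct.

Notation "v '\ox' w" := (tens v w) (at level 40, left associativity) : ring_scope.

Section TensorExtension.

Variables (K : fieldType) (Omega : choiceType) (A : lmodType K).
Variables (op ix : Omega -> Omega -> Omega).
Variable m : Omega -> {bilinear A -> A -> A}.

Local Notation KOA := (tensor (free_vect K Omega) A).

Definition ext_prod4 (f : free_vect K Omega) (x : A)
    (g : free_vect K Omega) (y : A) : KOA :=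
  free_lift (fun a => free_lift (fun b => basis_vect (op a b) \ox m (ix a b) x y) g) f.

(* The product on the tensor product extending bilinearly
   [(a \ox x, b \ox y) |-> op a b \ox m (ix a b) x y]: see [ext_prodE],
   and [ext_prod_unique] for the fact that this determines it. *)
Definition ext_prod (s t : KOA) : KOA :=
  tensor_lift (fun f x => tensor_lift (ext_prod4 f x) t) s.

Let ext_prod4_bilinearr f x : bilinear_for *:%R *:%R (ext_prod4 f x).
Proof.
split=> [y a g g'|g a y y'] /=; rewrite /ext_prod4 -free_liftP.
  by apply: eq_free_lift => c; rewrite linearP.
apply: eq_free_lift => c; rewrite -free_liftP; apply: eq_free_lift => d.
by rewrite linearPr /= linearPr.
Qed.

Let ext_prod4_bilinearl t :
  bilinear_for *:%R *:%R (fun f x => tensor_lift (ext_prod4 f x) t).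
Proof.
split=> [x a f f'|f a x x'] /=; rewrite /tensor_lift -free_liftP;
  apply: eq_free_lift => -[g y] /=; rewrite /ext_prod4; first exact: linearP.
rewrite -free_liftP; apply: eq_free_lift => c.
rewrite -free_liftP; apply: eq_free_lift => d.
by rewrite linearPl /= linearPr.
Qed.

Lemma ext_prod_bilinear : bilinear_for *:%R *:%R ext_prod.
Proof.
split=> [t a s s'|s a t t'] /=.
  exact: (tensor_lift_linear (ext_prod4_bilinearl t)).
pose L r (p : free_vect K Omega * A) := tensor_lift (ext_prod4 p.1 p.2) r.
have extE r : ext_prod s r = free_lift (L r) (repr s) by [].
rewrite (extE (a *: t + t')).
rewrite (extE t).
rewrite (extE t').
have step := free_liftP a (L t) (L t') (repr s).
apply: etrans step.
apply: eq_free_lift => p.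
exact: (tensor_lift_linear (ext_prod4_bilinearr p.1 p.2)).
Qed.

HB.instance Definition _ :=
  bilinear_isBilinear.Build K KOA KOA KOA *:%R *:%R ext_prod ext_prod_bilinear.

Lemma ext_prodE a b x y :
  ext_prod (basis_vect a \ox x) (basis_vect b \ox y) = basis_vect (op a b) \ox m (ix a b) x y.
Proof. by rewrite /ext_prod !tensor_liftE // /ext_prod4 !free_liftU. Qed.

Lemma ext_prod_unique (p : {bilinear KOA -> KOA -> KOA}) :
  (forall a b x y,
     p (basis_vect a \ox x) (basis_vect b \ox y) = basis_vect (op a b) \ox m (ix a b) x y) ->
  forall s t, p s t = ext_prod s t.
Proof.
move=> pE s t; have [ql qr] := ext_prod_bilinear.
move: s; apply: tensor_ext => [a s s'|//|f x]; first exact: linearPl.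
move: t; apply: tensor_ext => [a t t'|//|g y]; first exact: linearPr.
move: f; apply: free_ext => [a f f'|a f f'|a].
- by rewrite linearPl /= linearPl.
- by rewrite linearPl /= ql.
move: g; apply: free_ext => [b g g'|b g g'|b].
- by rewrite linearPl /= linearPr.
- by rewrite linearPl /= qr.
by rewrite pE ext_prodE.
Qed.

End TensorExtension.

(* Main.v *)
(** Pure tensors [basis_vect a \ox x] span, so each dendriform axiom on the
    tensor product only needs checking there, where the EDS axioms turn it into
    an instance of the corresponding Omega-dendriform axiom.
    For the converse, [x |-> basis_vect a \ox x] is injective, so what remains is
    to realise every pair of indices [(alpha, beta)].  The two outer axioms use
    one surjection twice.  The middle axiom involves the pair
    [(rt a b, lt b c)]: choose [(a, d)] with [rt a d = alpha], then [(b, c)]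
    with [la b c = d] and [lt b c = beta]; now [rt a b = rt a (la b c) = alpha]. *)
Require Import Defs.
From mathcomp Require Import all_boot all_algebra.
From mathcomp Require Import finmap monalg.

Set Implicit Arguments.
Unset Strict Implicit.
Unset Printing Implicit Defensive.

Import GRing.Theory.
Local Open Scope ring_scope.

Section FreeTensor.

Variables (K : fieldType) (X : choiceType) (A : lmodType K).

Local Notation KXA := (tensor (free_vect K X) A).
Local Notation "a '\ob' x" := (basis_vect a \ox x : KXA) (at level 40).

Lemma free_tensor_ext (Z : lmodType K) (F G : KXA -> Z) :
  linear F -> linear G -> (forall a x, F (a \ob x) = G (a \ob x)) -> F =1 G.
Proof.
move=> lF lG FG; apply: tensor_ext => // f x.
move: f; apply: free_ext => [k f f'|k f f'|a]; last exact: FG.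
  by rewrite linearPl lF.
by rewrite linearPl lG.
Qed.

(** Taking the coefficient at [a] gives the bilinear map [coef], whose lift to the tensor product is
    a linear left inverse. *)
Lemma tens_basis_inj (a : X) : injective (fun x : A => a \ob x).
Proof.
pose coef (f : free_vect K X) (x : A) :=
  free_lift (fun b => if b == a then x else 0) f.
have coefB : bilinear_for *:%R *:%R coef.
  split=> [x k f f'|f k x x'] /=; first by rewrite /coef linearP.
  rewrite /coef -free_liftP; apply: eq_free_lift => b.
  by case: ifP => // _; rewrite scaler0 addr0.
move=> x y /(congr1 (tensor_lift coef)).
by rewrite !tensor_liftE // /coef !free_liftU eqxx.
Qed.

Definition trilinear (F : KXA -> KXA -> KXA -> KXA) : Prop :=
  [/\ forall t u, linear (fun s => F s t u),
      forall s u, linear (fun t => F s t u) &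
      forall s t, linear (F s t)].

Lemma trilinear_ext (F G : KXA -> KXA -> KXA -> KXA) :
  trilinear F -> trilinear G ->
  (forall a b c x y z,
    F (a \ob x) (b \ob y) (c \ob z) = G (a \ob x) (b \ob y) (c \ob z)) ->
  forall s t u, F s t u = G s t u.
Proof.
move=> [F1 F2 F3] [G1 G2 G3] FG s t u.
apply: (free_tensor_ext (F1 t u) (G1 t u) _ s) => a x /=.
apply: (free_tensor_ext (F2 _ u) (G2 _ u) _ t) => b y /=.
by apply: (free_tensor_ext (F3 _ _) (G3 _ _) _ u) => c z.
Qed.

Lemma trilinear_compl (P Q : {bilinear KXA -> KXA -> KXA}) :
  trilinear (fun s t u => P (Q s t) u).
Proof.
split=> [t u k s s'|s u k t t'|s t k u u'] /=.
- by rewrite linearPl /= linearPl.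
- by rewrite linearPr /= linearPl.
- by rewrite linearPr.
Qed.

Lemma trilinear_compr (P Q : {bilinear KXA -> KXA -> KXA}) :
  trilinear (fun s t u => P s (Q t u)).
Proof.
split=> [t u k s s'|s u k t t'|s t k u u'] /=.
- by rewrite linearPl.
- by rewrite linearPl /= linearPr.
- by rewrite linearPr /= linearPr.
Qed.

Lemma trilinearD (F G : KXA -> KXA -> KXA -> KXA) :
  trilinear F -> trilinear G -> trilinear (fun s t u => F s t u + G s t u).
Proof.
move=> [F1 F2 F3] [G1 G2 G3].
by split=> [t u k s s'|s u k t t'|s t k u u'] /=;
  rewrite ?(F1, F2, F3) ?(G1, G2, G3) scalerDr addrACA.
Qed.

(** Once sums are expanded, both sides of each axiom are sums of composites of [P] and [S], hence
    trilinear. *)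
Lemma dendriform_free_tensor (P S : {bilinear KXA -> KXA -> KXA}) :
  (forall a b c x y z,
     let s := a \ob x in let t := b \ob y in let u := c \ob z in
     [/\ P (P s t) u = P s (P t u) + P s (S t u),
         P (S s t) u = S s (P t u) &
         S (P s t) u + S (S s t) u = S s (S t u)]) ->
  dendriform P S.
Proof.
move=> PS; split=> s t u.
- rewrite linearDr /=.
  apply: (trilinear_ext (trilinear_compl P P)
    (trilinearD (trilinear_compr P P) (trilinear_compr P S))) => a b c x y z.
  by case: (PS a b c x y z).
- apply: (trilinear_ext (trilinear_compl P S) (trilinear_compr S P)).
  by move=> a b c x y z; case: (PS a b c x y z).
- rewrite linearDl /=.
  apply: (trilinear_ext (trilinearD (trilinear_compl S P) (trilinear_compl S S))
    (trilinear_compr S S)) => a b c x y z.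
  by case: (PS a b c x y z).
Qed.

End FreeTensor.

Theorem proposition18 (K : fieldType) (Omega : choiceType)
    (la ra lt rt : Omega -> Omega -> Omega)
    (A : lmodType K) (prec succ : Omega -> {bilinear A -> A -> A}) :
  extended_diassociative_semigroup la ra lt rt ->
  let phi_la (p : Omega * Omega) := (la p.1 p.2, lt p.1 p.2) in
  let phi_ra (p : Omega * Omega) := (ra p.1 p.2, rt p.1 p.2) in
  let prec_KOA : {bilinear tensor (free_vect K Omega) A ->
        tensor (free_vect K Omega) A -> tensor (free_vect K Omega) A} :=
    ext_prod la lt prec in
  let succ_KOA : {bilinear tensor (free_vect K Omega) A ->
        tensor (free_vect K Omega) A -> tensor (free_vect K Omega) A} :=
    ext_prod ra rt succ in
  (Omega_dendriform la ra lt rt prec succ -> dendriform prec_KOA succ_KOA) /\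
  ((forall q, exists p, phi_la p = q) -> (forall q, exists p, phi_ra p = q) ->
   dendriform prec_KOA succ_KOA -> Omega_dendriform la ra lt rt prec succ).
Proof.
move=> [] [dll dlr drl drr drA] rt_l r_lt lt_l lt_lt lt_r lt_rt rt_lA rt_lt rt_r rt_rt.
move=> phi_la phi_ra P S.
have PE a b x y : P (basis_vect a \ox x) (basis_vect b \ox y)
    = basis_vect (la a b) \ox prec (lt a b) x y by exact: ext_prodE.
have SE a b x y : S (basis_vect a \ox x) (basis_vect b \ox y)
    = basis_vect (ra a b) \ox succ (rt a b) x y by exact: ext_prodE.
(* From here on, [P] and [S] are known only through their values on pure tensors and bilinearity. *)
clearbody P S; split=> [[pp sp ss]|sla sra [PP SP SS]].
  apply: dendriform_free_tensor => a b c x y z s t u.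
  rewrite /s /t /u !(PE, SE); split.
  (* [pp] applies at the indices [lt a b] and [lt (la a b) c]; [dll] and [dlr] then give all terms
     the same basis vector. *)
  - by rewrite pp linearDr lt_l lt_lt lt_r lt_rt dll -dlr.
  - by rewrite sp drl r_lt rt_l.
  - by rewrite ss linearDr rt_lA rt_lt rt_r rt_rt drr drA addrC.
split=> alpha beta x y z.
(* The aim is [alpha = lt a b] and [beta = lt (la a b) c], with [d = la a b]; only the second
   component of the first target matters. *)
- have [[d c] [_ dc]] := sla (alpha, beta).
  have [[a b] [/= abd <-]] := sla (d, alpha).
  rewrite -dc /= -abd; apply: (@tens_basis_inj K Omega A (la (la a b) c)) => /=.
  rewrite lt_l lt_lt lt_r lt_rt linearDr /= -PE -PE PP linearDr /=.
  by rewrite !(PE, SE) dll -dlr.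
(* The first [alpha] of the target is a filler: only [rt a d = alpha] is kept. *)
- have [[a d] [/= _ ad]] := sra (alpha, alpha).
  have [[b c] [/= bcd <-]] := sla (d, beta).
  rewrite -ad -bcd rt_l.
  apply: (@tens_basis_inj K Omega A (ra a (la b c))) => /=.
  have := SP (basis_vect a \ox x) (basis_vect b \ox y) (basis_vect c \ox z).
  by rewrite !(PE, SE) drl r_lt rt_l.
(* Now [alpha = rt a (ra b c)] and [beta = rt b c], with [d = ra b c]: the index pair at which [ss]
   was used in the direct implication. *)
- have [[a d] [/= _ ad]] := sra (alpha, alpha).
  have [[b c] [/= bcd <-]] := sra (d, beta).
  rewrite -ad -bcd rt_lA rt_lt rt_r rt_rt.
  apply: (@tens_basis_inj K Omega A (ra a (ra b c))) => /=.
  have := SS (basis_vect a \ox x) (basis_vect b \ox y) (basis_vect c \ox z).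
  by rewrite linearDl /= linearDr /= !(PE, SE) drr drA addrC => <-.
Qed.
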